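(* For $i=1,\cdots,r$ let $\Theta_i\in H^\infty_{M_{n\times m_i}}$ be matrix inner functions, and let $\Theta\in H^\infty_{M_{n\times l}}$ be a least common multiple of $\{\Theta_1,\cdots,\Theta_r\}$, i.e. a matrix inner function with $\bigcap_{i=1}^r\Theta_iH^2_{\mathbb C^{m_i}}=\Theta H^2_{\mathbb C^l}$. Then $n-\sum_{i=1}^r(n-m_i)\le l\le\min\{m_1,\cdots,m_r\}$.
   Context: A matrix function $\Theta\in H^\infty_{M_{n\times m}}$ is inner if $\Theta(\zeta)^*\Theta(\zeta)=I$ for a.e. $\zeta$ on the unit circle; $H^2_{\mathbb C^m}$ is the space of column vectors of $m$ functions in the Hardy space $H^2$. *)

(* Defs.v *)
(* Functions on the unit circle T are represented
   by functions on R, restricted to the parameter interval [0,1]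
   (zeta = exp(2 pi i t)), with Lebesgue measure on [0,1]. *)
From HB Require Import structures.
From mathcomp Require Import all_boot all_order all_algebra.
From mathcomp Require Import all_classical all_reals all_analysis.
From mathcomp Require Import complex.
Set Implicit Arguments. Unset Strict Implicit. Unset Printing Implicit Defensive.
Import Order.TTheory GRing.Theory Num.Theory.
Import numFieldNormedType.Exports.
Local Open Scope classical_set_scope.
Local Open Scope ring_scope.

Section Hardy.
Variable R : realType.
Local Notation C := (complex R).
Local Notation mu := (@lebesgue_measure R).
Local Notation I01 := ([set` `[(0:R), 1]%R] : set R).

Definition L2fun (f : R -> C) : Prop :=
  measurable_fun I01 (fun t => complex.Re (f t)) /\
  measurable_fun I01 (fun t => complex.Im (f t)) /\
  mu.-integrable I01 (fun t => ((complex.Re (f t)) ^+ 2)%:E) /\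
  mu.-integrable I01 (fun t => ((complex.Im (f t)) ^+ 2)%:E).

(* k-th Fourier coefficient  \int_0^1 f(t) e^{-2 pi i k t} dt *)
Definition fourier_coef (f : R -> C) (k : int) : C :=
  let th t := 2 * pi * k%:~R * t in
  Complex
    (Rintegral mu I01 (fun t => complex.Re (f t) * cos (th t)
                                + complex.Im (f t) * sin (th t)))
    (Rintegral mu I01 (fun t => complex.Im (f t) * cos (th t)
                                - complex.Re (f t) * sin (th t))).

Definition H2 (f : R -> C) : Prop :=
  L2fun f /\ forall k : nat, (0 < k)%N -> fourier_coef f (- k%:Z) = 0.

Definition H2vec (m : nat) (f : R -> 'cV[C]_m) : Prop :=
  forall i : 'I_m, H2 (fun t => f t i 0).

Definition Linfty (f : R -> C) : Prop :=
  measurable_fun I01 (fun t => complex.Re (f t)) /\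
  measurable_fun I01 (fun t => complex.Im (f t)) /\
  exists M : R, {ae mu, forall t, I01 t ->
     `|complex.Re (f t)| <= M /\ `|complex.Im (f t)| <= M}.

Definition Hinfty (f : R -> C) : Prop :=
  Linfty f /\ forall k : nat, (0 < k)%N -> fourier_coef f (- k%:Z) = 0.

Definition HinftyM (n m : nat) (T : R -> 'M[C]_(n, m)) : Prop :=
  forall (i : 'I_n) (j : 'I_m), Hinfty (fun t => T t i j).

Definition adjmx (n m : nat) (A : 'M[C]_(n, m)) : 'M[C]_(m, n) :=
  (map_mx (@conjc R) A)^T.

Definition inner (n m : nat) (T : R -> 'M[C]_(n, m)) : Prop :=
  HinftyM T /\ {ae mu, forall t, I01 t -> adjmx (T t) *m T t = 1%:M}.

Definition inThetaH2 (n m : nat) (T : R -> 'M[C]_(n, m))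
    (f : R -> 'cV[C]_n) : Prop :=
  exists g : R -> 'cV[C]_m, H2vec g /\
    {ae mu, forall t, I01 t -> f t = T t *m g t}.

End Hardy.

(* Main.v *)
(** The range inclusions give [Theta = Theta_i G] almost everywhere, whence the upper
    bound by comparing ranks at a point.  For the lower bound, look at the linear system
    [f = Theta_i g_i] (all [i]) in the [n + \sum_i m_i] unknowns [(f, g_1, ..., g_r)],
    which consists of [r n] equations.  Choosing a minor of maximal size that does not
    vanish a.e. and applying Cramer's rule produces solutions with entries in H^infty
    that span, on a set of positive measure, a space of dimension at least
    [n + \sum_i m_i - r n].  Since [g_i = Theta_i^* f], the [f]-components span a space
    of the same dimension; they lie in every [Theta_i H^2], hence in [Theta H^2], so that
    dimension is at most [l].

    Cramer's rule needs H^infty to be closed under products, which with the definition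
    by Fourier coefficients is the assertion that [\int f g = 0] when [f] has no negative
    and [g] no nonpositive frequencies.  This follows from the L^2-density of
    trigonometric polynomials: the part of nonnegative frequencies of an approximation of
    [f] is at least as good an approximation. *)

Require Import Defs.
From HB Require Import structures.
From mathcomp Require Import all_boot all_order all_algebra.
From mathcomp Require Import all_classical all_reals all_analysis.
From mathcomp Require Import measurable_realfun complex.
From mathcomp Require Import ring lra.
Import Order.TTheory GRing.Theory Num.Theory.
Import numFieldNormedType.Exports.
Local Open Scope ring_scope.

Set Implicit Arguments.
Unset Strict Implicit.
Unset Printing Implicit Defensive.

(** * Approximation by trigonometric polynomials *)

Section BoundedMeasurable.
Local Open Scope classical_set_scope.
Variable R : realType.
Local Notation mu := (@lebesgue_measure R).
Local Notation I01 := ([set` `[(0:R), 1]%R] : set R).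
Implicit Types f g h p : R -> R.

(** The bound holds at every point of [0,1], not just almost everywhere, so products stay in the
    class and estimates under the integral need no exceptional set. Essentially bounded functions
    are brought here by [Linfty_bmcfun]. *)
Definition bmfun h : Prop := measurable_fun I01 h /\
  exists M, forall t, I01 t -> `|h t| <= M.

Lemma measurable_I01 : measurable I01.
Proof. by []. Qed.
Local Hint Resolve measurable_I01 : core.

Lemma mu_I01 : mu I01 = 1%E.
Proof. by rewrite lebesgue_measure_itv /= lte_fin ltr01 oppr0 adde0. Qed.

Lemma bmfun_integrable h : bmfun h -> mu.-integrable I01 (EFin \o h).
Proof.
move=> [mh [M hM]]; apply: measurable_bounded_integrable => //.
  by rewrite [X in (X < _)%E]mu_I01 ltry.
exists M; split; first exact: num_real.
by move=> x Mx t /hM /le_trans; apply; exact: ltW.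
Qed.

Lemma eq_bmfun g h : {in I01, g =1 h} -> bmfun h -> bmfun g.
Proof.
move=> gh [mh [M hM]]; split.
  by apply: eq_measurable_fun mh => x xD; rewrite gh.
by exists M => t Dt; rewrite gh ?inE //; exact: hM.
Qed.

Lemma bmfun_cst c : bmfun (fun=> c).
Proof. by split; [exact: measurable_cst | exists `|c|]. Qed.

Lemma bmfunD g h : bmfun g -> bmfun h -> bmfun (fun t => g t + h t).
Proof.
move=> [mg [M gM]] [mh [N hN]]; split; first exact: measurable_funD.
by exists (M + N) => t Dt; apply: le_trans (ler_normD _ _) _; rewrite lerD ?gM ?hN.
Qed.

Lemma bmfunM g h : bmfun g -> bmfun h -> bmfun (fun t => g t * h t).
Proof.
move=> [mg [M gM]] [mh [N hN]]; split; first exact: measurable_funM.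
by exists (M * N) => t Dt; rewrite normrM ler_pM ?gM ?hN.
Qed.

Lemma bmfunZ c h : bmfun h -> bmfun (fun t => c * h t).
Proof. by move=> bh; apply: bmfunM => //; exact: bmfun_cst. Qed.

Lemma bmfunN h : bmfun h -> bmfun (fun t => - h t).
Proof.
by move=> bh; apply: eq_bmfun (bmfunZ (-1) bh) => t _; rewrite mulN1r.
Qed.

Lemma bmfunB g h : bmfun g -> bmfun h -> bmfun (fun t => g t - h t).
Proof. by move=> bg bh; apply: bmfunD => //; exact: bmfunN. Qed.

Lemma bmfunX h n : bmfun h -> bmfun (fun t => h t ^+ n).
Proof.
move=> bh; elim: n => [|n ih]; first exact: bmfun_cst.
by apply: eq_bmfun (bmfunM bh ih) => t _; rewrite exprS.
Qed.

Lemma continuous_bmfun h : continuous h ->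
  (exists M, forall t, `|h t| <= M) -> bmfun h.
Proof.
move=> ch [M hM]; split; last by exists M.
apply: (measurable_funS measurableT) => //.
exact: continuous_measurable_fun.
Qed.

Lemma bmfun_indic (E : set R) : measurable E -> bmfun (\1_E).
Proof.
move=> mE; split; first exact: measurable_indic.
by exists 1 => t _; rewrite indicE; case: (_ \in _); rewrite ?normr1 ?normr0.
Qed.

Local Notation "'In' h" := (Rintegral mu I01 h) (at level 10, h at level 8).

Lemma RintD g h : bmfun g -> bmfun h ->
  In (fun t => g t + h t) = In g + In h.
Proof. by move=> bg bh; rewrite RintegralD //; exact: bmfun_integrable. Qed.

Lemma RintZ c h : bmfun h -> In (fun t => c * h t) = c * In h.
Proof. by move=> bh; rewrite RintegralZl //; exact: bmfun_integrable. Qed.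

Lemma RintN h : bmfun h -> In (fun t => - h t) = - In h.
Proof.
move=> bh; rewrite -mulN1r -RintZ //.
by apply: eq_Rintegral => t _; rewrite mulN1r.
Qed.

Lemma RintB g h : bmfun g -> bmfun h ->
  In (fun t => g t - h t) = In g - In h.
Proof. by move=> bg bh; rewrite RintD ?RintN //; exact: bmfunN. Qed.

Lemma Rint_cst c : In (fun=> c) = c.
Proof. by rewrite Rintegral_cst // [X in fine X]mu_I01 mulr1. Qed.

Lemma ler_Rint g h : bmfun g -> bmfun h ->
  (forall t, I01 t -> g t <= h t) -> In g <= In h.
Proof. by move=> bg bh gh; apply: le_Rintegral => //; exact: bmfun_integrable. Qed.

Lemma ae01S (P Q : R -> Prop) : (forall t, P t -> Q t) ->
  {ae mu, forall t, I01 t -> P t} -> {ae mu, forall t, I01 t -> Q t}.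
Proof.
move=> PQ; apply: (@filterS _ _ (ae_filter_ringOfSetsType mu)) => t Pt Dt.
exact/PQ/Pt.
Qed.

Lemma ae01T (P : R -> Prop) : (forall t, I01 t -> P t) ->
  {ae mu, forall t, I01 t -> P t}.
Proof. by move=> hP; apply: (@filterE _ _ (ae_filter_ringOfSetsType mu)). Qed.

Lemma ae01I (P Q : R -> Prop) : {ae mu, forall t, I01 t -> P t} ->
  {ae mu, forall t, I01 t -> Q t} -> {ae mu, forall t, I01 t -> P t /\ Q t}.
Proof.
move=> aP aQ; move: (@filterI _ _ (ae_filter_ringOfSetsType mu) _ _ aP aQ).
apply: (@filterS _ _ (ae_filter_ringOfSetsType mu)) => t [Pt Qt] Dt.
by split; [exact: Pt|exact: Qt].
Qed.

Lemma ae_eq_Rint g h : measurable_fun I01 g -> measurable_fun I01 h ->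
  {ae mu, forall t, I01 t -> g t = h t} -> In g = In h.
Proof.
move=> mg mh gh; congr fine; apply: ae_eq_integral => //.
- exact/measurable_EFinP.
- exact/measurable_EFinP.
by apply: ae01S gh => t ->.
Qed.

(** The parameters 0 and 1 are one point of the circle, so 1-periodic functions cannot tell them
    apart; as a null set they may be left out. *)
Lemma ae_itv_oo (P : R -> Prop) :
  (forall t, 0 < t < 1 -> P t) -> {ae mu, forall t, I01 t -> P t}.
Proof.
move=> hP; exists [set 0; 1]; split.
- exact: measurableU.
- rewrite null_set_setU //; exact: lebesgue_measure_set1.
move=> t /= /not_implyP[]; rewrite in_itv /= => /andP[t0 t1] nP.
apply: contrapT => /not_orP[/eqP n0 /eqP n1]; apply: nP; apply: hP.
by rewrite !lt_neqAle eq_sym n0 n1 t0 t1.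
Qed.

(** * Trigonometric polynomials and their bounded L^2-limits *)

Inductive trigpoly : (R -> R) -> Prop :=
| trigpoly_cst c : trigpoly (fun=> c)
| trigpoly_cos : trigpoly (fun t => cos (2 * pi * t))
| trigpoly_sin : trigpoly (fun t => sin (2 * pi * t))
| trigpolyD g h : trigpoly g -> trigpoly h -> trigpoly (fun t => g t + h t)
| trigpolyM g h : trigpoly g -> trigpoly h -> trigpoly (fun t => g t * h t).

Lemma continuous_cosZ (a : R) : continuous (fun t => cos (a * t)).
Proof.
move=> t; apply: continuous_comp; last exact: continuous_cos.
exact: mulrl_continuous.
Qed.

Lemma continuous_sinZ (a : R) : continuous (fun t => sin (a * t)).
Proof.
move=> t; apply: continuous_comp; last exact: continuous_sin.
exact: mulrl_continuous.
Qed.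

Lemma bmfun_cosZ a : bmfun (fun t => cos (a * t)).
Proof.
by apply: continuous_bmfun; [exact: continuous_cosZ | exists 1 => t; exact: cos_max].
Qed.

Lemma bmfun_sinZ a : bmfun (fun t => sin (a * t)).
Proof.
by apply: continuous_bmfun; [exact: continuous_sinZ | exists 1 => t; exact: sin_max].
Qed.

Lemma trigpoly_bmfun p : trigpoly p -> bmfun p.
Proof.
elim=> [c|||g h _ bg _ bh|g h _ bg _ bh].
- exact: bmfun_cst.
- exact: bmfun_cosZ.
- exact: bmfun_sinZ.
- exact: bmfunD.
- exact: bmfunM.
Qed.

Definition sqdist g h := In (fun t => (g t - h t) ^+ 2).

(** The L^2-closure of the trigonometric polynomials within the bounded functions; boundedness is
    what keeps this closure an algebra. It turns out to contain every bounded measurable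
    function. *)
Definition L2trig h : Prop := bmfun h /\
  forall e, 0 < e -> exists2 p, trigpoly p & sqdist h p < e.

Lemma bmfun_sqdist g h : bmfun g -> bmfun h -> bmfun (fun t => (g t - h t) ^+ 2).
Proof. by move=> bg bh; apply: bmfunX; exact: bmfunB. Qed.

(** Integrated form of (a + b)^2 <= 2 a^2 + 2 b^2. Working with the squared distance avoids square
    roots at the price of the factor 2. *)
Lemma sqdist_triangle f g h : bmfun f -> bmfun g -> bmfun h ->
  sqdist f h <= 2 * sqdist f g + 2 * sqdist g h.
Proof.
move=> bf bg bh; have bfg := bmfun_sqdist bf bg.
have bgh := bmfun_sqdist bg bh.
rewrite /sqdist -!RintZ // -RintD; [|exact: bmfunZ..].
apply: ler_Rint; [exact: bmfun_sqdist|by apply: bmfunD; exact: bmfunZ|].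
move=> t _; have := sqr_ge0 (f t - g t - (g t - h t)); nra.
Qed.

Lemma sqdist_mul M f g h : bmfun f -> bmfun g -> bmfun h ->
  (forall t, I01 t -> `|f t| <= M) ->
  sqdist (fun t => f t * g t) (fun t => f t * h t) <= M ^+ 2 * sqdist g h.
Proof.
move=> bf bg bh fM; have bgh := bmfun_sqdist bg bh.
rewrite /sqdist -RintZ //.
apply: ler_Rint; [by apply: bmfun_sqdist; exact: bmfunM|exact: bmfunZ|].
move=> t Dt; rewrite -mulrBr exprMn ler_wpM2r ?sqr_ge0 //.
by rewrite -real_normK ?num_real // ler_pXn2r ?nnegrE ?fM // (le_trans _ (fM t Dt)).
Qed.

Lemma L2trig_approx f : bmfun f ->
  (forall e, 0 < e -> exists2 h, L2trig h & sqdist f h < e) -> L2trig f.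
Proof.
move=> bf fP; split=> // e e0.
have [h [bh hP] fh] := fP (e / 4) ltac:(by lra).
have [p tp hp] := hP (e / 4) ltac:(by lra); exists p => //.
have := sqdist_triangle bf bh (trigpoly_bmfun tp); lra.
Qed.

Lemma trigpoly_L2trig p : trigpoly p -> L2trig p.
Proof.
move=> tp; split; first exact: trigpoly_bmfun.
move=> e e0; exists p => //; rewrite /sqdist (@eq_Rintegral _ _ _ _ _ (fun=> 0)).
  by rewrite Rint_cst.
by move=> t _; rewrite subrr expr0n.
Qed.

Lemma L2trig_ae f h : bmfun f -> L2trig h ->
  (forall t, 0 < t < 1 -> f t = h t) -> L2trig f.
Proof.
move=> bf Lh fh; have [bh _] := Lh; apply: L2trig_approx => // e e0; exists h => //.
rewrite /sqdist (@ae_eq_Rint _ (fun=> 0)) ?Rint_cst //.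
- by case: (bmfun_sqdist bf bh).
- by apply: ae_itv_oo => t /fh ->; rewrite subrr expr0n.
Qed.

Lemma eq_L2trig g h : g =1 h -> L2trig h -> L2trig g.
Proof. by move=> /funext ->. Qed.

Lemma L2trig_cst c : L2trig (fun=> c).
Proof. exact: trigpoly_L2trig (trigpoly_cst c). Qed.

Lemma L2trigD g h : L2trig g -> L2trig h -> L2trig (fun t => g t + h t).
Proof.
move=> [bg gP] [bh hP]; split=> [|e e0]; first exact: bmfunD.
have [p tp gp] := gP (e / 4) ltac:(by lra).
have [q tq hq] := hP (e / 4) ltac:(by lra).
have bp := trigpoly_bmfun tp; have bq := trigpoly_bmfun tq.
exists (fun t => p t + q t); first exact: trigpolyD.
have bpg := bmfun_sqdist bg bp; have bqh := bmfun_sqdist bh bq.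
suff: sqdist (fun t => g t + h t) (fun t => p t + q t) <=
   2 * sqdist g p + 2 * sqdist h q by lra.
rewrite /sqdist -!RintZ // -RintD; [|exact: bmfunZ..].
apply: ler_Rint; [by apply: bmfun_sqdist; exact: bmfunD|by apply: bmfunD; exact: bmfunZ|].
move=> t _; have := sqr_ge0 (g t - p t - (h t - q t)); nra.
Qed.

Lemma L2trigM g h : L2trig g -> L2trig h -> L2trig (fun t => g t * h t).
Proof.
(* Multiplication by a bounded function is L^2-continuous, so the factors are replaced by
   polynomials one at a time: here one factor already is a polynomial, and the general case reduces
   to this one. *)
have main p g1 : trigpoly p -> L2trig g1 -> L2trig (fun t => p t * g1 t).
  move=> tp Lh; have [bh hP] := Lh; have bp := trigpoly_bmfun tp.
  apply: L2trig_approx => [|e e0]; first exact: bmfunM.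
  (* Adding 1 keeps the divisor positive even when M = 0. *)
  have [M pM] := bp.2; have M0 : 0 < M ^+ 2 + 1 by rewrite ltr_wpDl ?sqr_ge0.
  have [q tq hq] := hP (e / (M ^+ 2 + 1)) ltac:(by rewrite divr_gt0).
  exists (fun t => p t * q t); first exact/trigpoly_L2trig/trigpolyM.
  apply: le_lt_trans (sqdist_mul bp bh (trigpoly_bmfun tq) pM) _.
  have s0 : 0 <= sqdist g1 q by apply: Rintegral_ge0 => t _; exact: sqr_ge0.
  move: hq; rewrite ltr_pdivlMr // => hq; nra.
move=> Lg Lh; have [bg gP] := Lg; have [bh hP] := Lh.
apply: L2trig_approx => [|e e0]; first exact: bmfunM.
have [M hM] := bh.2; have M0 : 0 < M ^+ 2 + 1 by rewrite ltr_wpDl ?sqr_ge0.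
have [q tq hq] := gP (e / (M ^+ 2 + 1)) ltac:(by rewrite divr_gt0).
exists (fun t => q t * h t); first exact: main.
have := sqdist_mul bh bg (trigpoly_bmfun tq) hM.
rewrite (_ : (fun t => h t * g t) = (fun t => g t * h t)); last first.
  by apply/funext => t; rewrite mulrC.
rewrite (_ : (fun t => h t * q t) = (fun t => q t * h t)); last first.
  by apply/funext => t; rewrite mulrC.
move=> /le_lt_trans; apply.
have s0 : 0 <= sqdist g q by apply: Rintegral_ge0 => t _; exact: sqr_ge0.
move: hq; rewrite ltr_pdivlMr // => hq; nra.
Qed.

Lemma L2trigZ c h : L2trig h -> L2trig (fun t => c * h t).
Proof. by apply: L2trigM; exact: L2trig_cst. Qed.

Lemma L2trig_sum n (F : nat -> R -> R) : (forall k, L2trig (F k)) ->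
  L2trig (fun t => \sum_(k < n) F k t).
Proof.
move=> LF; elim: n => [|n ih].
  by apply: eq_L2trig (L2trig_cst 0) => t; rewrite big_ord0.
by apply: eq_L2trig (L2trigD ih (LF n)) => t; rewrite big_ord_recr.
Qed.

(** Bounded pointwise convergence implies L^2-convergence: the squared errors are dominated by the
    constant (2 M)^2. *)
Lemma L2trig_cvg (h_ : nat -> R -> R) h (M : R) : (forall n, L2trig (h_ n)) ->
  (forall n t, I01 t -> `|h_ n t| <= M) ->
  (forall t, I01 t -> h_ ^~ t @ \oo --> h t) -> L2trig h.
Proof.
move=> Lh hM hc.
have mh : measurable_fun I01 h.
  by apply: measurable_fun_cvg hc => n; have [[]] := Lh n.
have hb t : I01 t -> `|h t| <= M.
  move=> Dt; have cn : (fun n => `|h_ n t|) @ \oo --> `|h t|.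
    by apply: cvg_norm; exact: hc.
  rewrite -(cvg_lim (@Rhausdorff R) cn); apply: limr_le.
    by apply/cvg_ex; exists `|h t|.
  by near=> n; exact: hM.
have bh : bmfun h by split=> //; exists M.
apply: L2trig_approx => // e e0.
pose F n t := ((h t - h_ n t) ^+ 2)%:E.
have bF n : bmfun (fun t => (h t - h_ n t) ^+ 2).
  by apply: bmfun_sqdist => //; case: (Lh n).
have [||||| _ _ FI] := @dominated_convergence _ _ _ mu I01 measurable_I01 F
  (fun=> 0%E) (fun=> ((M + M) ^+ 2)%:E).
- by move=> n; apply/measurable_EFinP; case: (bF n).
- exact: measurable_cst.
- apply: aeW => t Dt; apply: cvg_EFin; first by near=> n.
  rewrite [X in X @ _ --> _](_ : _ = (fun n => (h t - h_ n t) * (h t - h_ n t))).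
    have z : (fun n => h t - h_ n t) @ \oo --> (0 : R).
      by rewrite -(subrr (h t)); apply: cvgB; [exact: cvg_cst|exact: hc].
    by rewrite -[X in _ --> X](mulr0 (0 : R)); exact: cvgM.
  by apply/funext => n /=; rewrite expr2.
- exact: (bmfun_integrable (bmfun_cst ((M + M) ^+ 2))).
- apply: aeW => t n Dt; rewrite /F abse_EFin lee_fin normrX.
  have M0 : 0 <= M by apply: le_trans (hb t Dt).
  rewrite ler_pXn2r ?nnegrE ?addr_ge0 //.
  by apply: le_trans (ler_normB _ _) _; rewrite lerD ?hb ?hM.
move: FI; rewrite integral0 => /fine_cvgP[_ /cvgrPdist_lt /(_ e e0)].
move=> [N _ /(_ N (leqnn N))] /=.
rewrite sub0r normrN => /(le_lt_trans (ler_norm _)) hN.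
by exists (h_ N).
Unshelve. all: by end_near.
Qed.

End BoundedMeasurable.

(** * Density: from level sets to indicators to bounded measurable functions *)

Section TrigDensity.
Local Open Scope classical_set_scope.
Variable R : realType.
Local Notation I01 := ([set` `[(0:R), 1]%R] : set R).
Implicit Types (f g h p : R -> R) (x y t : R).

(* Polynomials that converge boundedly to the sign on [-1, 1], so that level sets of an
   element of the algebra [L2trig] have their indicators in it. *)
Fixpoint sgiter n x : R :=
  if n is k.+1 then (3 * sgiter k x - sgiter k x ^+ 3) / 2 else x.

Lemma sgiterN n x : sgiter n (- x) = - sgiter n x.
Proof. by elim: n => //= n ->; ring. Qed.

Lemma sgiter0 n : sgiter n 0 = 0.
Proof. by elim: n => //= n ->; rewrite mulr0 expr0n /= subr0 mul0r. Qed.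

(** The map y -> (3 y - y^3) / 2 increases y on (0,1] without passing its fixed point 1, and
    multiplies 1 - y by (1 - y)(2 + y) / 2. Since y >= x, this factor is at most 1 - x / 2, whence
    geometric convergence. *)
Lemma sgiter_gt0 n x : 0 < x <= 1 ->
  [/\ x <= sgiter n x, sgiter n x <= 1 & 1 - sgiter n x <= (1 - x / 2) ^+ n].
Proof.
move=> /andP[x0 x1]; elim: n => [|n [xy y1 yn]]; first by rewrite expr0 /=; split; lra.
rewrite /=; set y := sgiter n x in xy y1 yn *.
have y0 : 0 < y by lra.
have e1 : (3 * y - y ^+ 3) / 2 - y = y * (1 - y) * (1 + y) / 2 by field.
have e2 : 1 - (3 * y - y ^+ 3) / 2 = (1 - y) * ((1 - y) * (2 + y) / 2) by field.
have p1 : 0 <= y * (1 - y) * (1 + y) by rewrite !mulr_ge0 //; lra.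
have p2 : 0 <= (1 - y) * (2 + y) / 2 by rewrite !mulr_ge0 ?invr_ge0 //; lra.
have p3 : (1 - y) * (2 + y) / 2 <= 1 - x / 2 by nra.
have p4 : 0 <= 1 - y by lra.
split; first by lra.
- by rewrite -subr_ge0 e2 mulr_ge0.
- by rewrite e2 (exprSr _ n); apply: ler_pM.
Qed.

Lemma normr_sgiter n x : `|x| <= 1 -> `|sgiter n x| <= 1.
Proof.
have pos y : 0 < y -> y <= 1 -> `|sgiter n y| <= 1.
  move=> y0 y1; have [|h1 h2 _] := @sgiter_gt0 n y; first by rewrite y0.
  by rewrite ger0_norm //; lra.
rewrite ler_norml => /andP[h1 h2]; case: (ltgtP x 0) => x0.
- by rewrite -(opprK x) sgiterN normrN pos //; lra.
- exact: pos.
- by rewrite x0 sgiter0 normr0.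
Qed.

Lemma cvg_sgiter x : `|x| <= 1 -> sgiter ^~ x @ \oo --> Num.sg x.
Proof.
have pos y : 0 < y -> y <= 1 -> sgiter ^~ y @ \oo --> (1 : R).
  move=> y0 y1; apply/subr_cvg0.
  have geo : (fun n => (1 - y / 2) ^+ n) @ \oo --> (0 : R).
    by apply: cvg_expr; rewrite ger0_norm; lra.
  have geoN : (fun n => - (1 - y / 2) ^+ n) @ \oo --> (0 : R).
    by rewrite -oppr0; exact: cvgN.
  apply: squeeze_cvgr geoN geo; near=> n.
  have [|h1 h2 h3] := @sgiter_gt0 n y; first by rewrite y0.
  have : 0 <= (1 - y / 2) ^+ n by rewrite exprn_ge0 //; lra.
  by move=> ?; apply/andP; split; lra.
rewrite ler_norml => /andP[h1 h2]; case: (ltgtP x 0) => x0.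
- rewrite ltr0_sg //.
  rewrite [X in X @ _ --> _](_ : _ = (fun n => - sgiter n (- x))).
    by apply: cvgN; apply: pos; lra.
  by apply/funext => n; rewrite sgiterN opprK.
- by rewrite gtr0_sg //; exact: pos.
- rewrite x0 sgr0 [X in X @ _ --> _](_ : _ = (fun=> 0)); first exact: cvg_cst.
  by apply/funext => n; rewrite sgiter0.
Unshelve. all: by end_near.
Qed.

Lemma L2trig_sgiter n h : L2trig h -> L2trig (fun t => sgiter n (h t)).
Proof.
move=> Lh; elim: n => //= n ih.
have L3 := L2trigM ih (L2trigM ih ih).
apply: eq_L2trig (L2trigZ 2^-1 (L2trigD (L2trigZ 3 ih) (L2trigZ (-1) L3))) => t /=.
by field.
Qed.

Lemma L2trig_sg h : L2trig h -> L2trig (fun t => Num.sg (h t)).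
Proof.
(* Scaling by the positive constant [c] brings [h] into [-1,1], where the iteration converges,
   without changing the sign. *)
move=> Lh; have [M hM] := Lh.1.2; pose c := (`|M| + 1)^-1.
have c0 : 0 < c by rewrite invr_gt0 ltr_wpDl.
have ch t : I01 t -> `|c * h t| <= 1.
  move=> /hM hMt; rewrite normrM gtr0_norm // mulrC ler_pdivrMr ?ltr_wpDl //.
  by rewrite mul1r (le_trans hMt) // (le_trans (ler_norm M)) // lerDl.
apply: (@L2trig_cvg _ (fun n t => sgiter n (c * h t)) _ 1).
- by move=> n; apply: L2trig_sgiter; exact: L2trigZ.
- by move=> n t Dt; apply: normr_sgiter; exact: ch.
- move=> t Dt; have := cvg_sgiter (ch t Dt).
  by rewrite sgrM (gtr0_sg c0) mul1r.
Qed.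

(** The indicator of {h > 0} is (s + s^2) / 2, with s the sign of h. *)
Lemma L2trig_gt0 h : L2trig h -> L2trig (fun t => (0 < h t)%R%:R).
Proof.
move=> /L2trig_sg Ls.
apply: eq_L2trig (L2trigZ 2^-1 (L2trigD Ls (L2trigM Ls Ls))) => t.
by case: sgrP => _ /=; lra.
Qed.

Lemma L2trig_compl (E : set R) : L2trig (\1_E) -> L2trig (\1_(~` E)).
Proof.
move=> LE; apply: eq_L2trig (L2trigD (L2trig_cst 1) (L2trigZ (-1) LE)) => t.
by rewrite !indicE in_setC; case: (_ \in _) => /=; lra.
Qed.

Lemma L2trig_setU (E F : set R) :
  L2trig (\1_E) -> L2trig (\1_F) -> L2trig (\1_(E `|` F)).
Proof.
move=> LE LF; have LEF := L2trigZ (-1) (L2trigM LE LF).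
apply: eq_L2trig (L2trigD (L2trigD LE LF) LEF) => t.
by rewrite !indicE in_setU; do 2 case: (_ \in _) => /=; lra.
Qed.

Lemma L2trig_bigcup (F : nat -> set R) :
  (forall n, L2trig (\1_(F n))) -> L2trig (\1_(\bigcup_n F n)).
Proof.
move=> LF; pose G n := \big[setU/set0]_(i < n) F i.
apply: (@L2trig_cvg _ (fun n => \1_(G n)) _ 1).
- rewrite /G; elim=> [|n ih]; last by rewrite big_ord_recr; exact: L2trig_setU.
  by rewrite big_ord0; apply: eq_L2trig (L2trig_cst 0) => t; rewrite indic0.
- by move=> n t _; rewrite indicE; case: (_ \in _); rewrite ?normr1 ?normr0.
move=> t _; have [[n _ Fn]|nF] := pselect ((\bigcup_n F n) t).
  rewrite (_ : \1_(\bigcup_n F n) t = 1); last by rewrite indicE mem_set //; exists n.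
  apply: cvg_near_cst; exists n.+1 => // k /= nk.
  rewrite indicE mem_set // /G -bigcup_mkord; exists n => //=.
rewrite (_ : \1_(\bigcup_n F n) t = 0); last by rewrite indicE memNset.
apply: cvg_near_cst; exists 0%N => // k _ /=; rewrite indicE memNset //.
by rewrite /G -bigcup_mkord => -[i /= _ Fi]; apply: nF; exists i.
Qed.

Lemma cos2pi_sym t : cos (2 * pi * (1 - t)) = cos (2 * pi * t).
Proof.
rewrite mulrBr mulr1 -[RHS]cosN -[RHS]cosD2pi; congr cos; ring.
Qed.

Lemma sin2pi_sym t : sin (2 * pi * (1 - t)) = - sin (2 * pi * t).
Proof.
rewrite mulrBr mulr1 -[RHS]sinN -[RHS]sinD2pi; congr sin; ring.
Qed.

Lemma sin2pi_gt0 t : 0 < t < 1 -> (0 < sin (2 * pi * t)) = (t < 2^-1).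
Proof.
have pi0 := pi_gt0 R.
have pos x : 0 < x < 2^-1 -> 0 < sin (2 * pi * x).
  by move=> /andP[x0 x1]; apply: sin_gt0_pi; rewrite !mulr_gt0 //=; nra.
move=> /andP[t0 t1]; case: (ltgtP t 2^-1) => th.
- by rewrite pos ?t0.
- apply/negbTE; rewrite -leNgt -oppr_ge0 -sin2pi_sym ltW // pos //.
  by apply/andP; split; lra.
- by rewrite th mulrAC divff ?pnatr_eq0 // mul1r sinpi ltxx.
Qed.

Lemma ltr_cos2pi t x : 0 <= t <= 2^-1 -> 0 <= x <= 2^-1 ->
  (cos (2 * pi * x) < cos (2 * pi * t)) = (t < x).
Proof.
have pi0 := pi_gt0 R.
move=> /andP[t0 t1] /andP[x0 x1]; rewrite ltr_cos.
- by rewrite ltr_pM2l // mulr_gt0.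
- by rewrite in_itv /= !mulr_ge0 ?pi_ge0 //=; nra.
- by rewrite in_itv /= !mulr_ge0 ?pi_ge0 //=; nra.
Qed.

(** Inside (0,1) a ray is cut out by level sets of sine and cosine. The sign of sin (2 pi t) tells
    the two halves of the interval apart, and on each half cos (2 pi t) is monotone, so comparing it
    with cos (2 pi x) compares t with x. *)
Lemma L2trig_ray x : L2trig (\1_(`[x, +oo[%classic : set R)).
Proof.
have bx : bmfun (\1_(`[x, +oo[%classic : set R)) by exact: bmfun_indic.
have Lc := trigpoly_L2trig (trigpoly_cos R).
have Ls := trigpoly_L2trig (trigpoly_sin R).
have iE t : \1_(`[x, +oo[%classic : set R) t = (x <= t)%R%:R.
  by rewrite indicE mem_setE in_itv /= andbT.
case: (ltP x 0) => x0.
  apply: L2trig_ae bx (L2trig_cst 1) _ => t /andP[t0 t1].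
  by rewrite iE (_ : x <= t) //; lra.
case: (leP 1 x) => x1.
  apply: L2trig_ae bx (L2trig_cst 0) _ => t /andP[t0 t1].
  by rewrite iE leNgt (_ : t < x) //; lra.
(* For x <= 1/2 the ray is the complement of (0,x), the set where the sine is positive and the
   cosine exceeds cos (2 pi x). *)
case: (leP x 2^-1) => xh.
  have L1 := L2trig_gt0 (L2trigD Lc (L2trig_cst (- cos (2 * pi * x)))).
  apply: L2trig_ae bx (L2trigD (L2trig_cst 1)
     (L2trigZ (-1) (L2trigM (L2trig_gt0 Ls) L1))) _ => t t01.
  rewrite iE sin2pi_gt0 // subr_gt0; have /andP[t0 t1] := t01.
  case: (ltP t 2^-1) => th /=; last first.
    by rewrite (_ : x <= t) ?mul0r ?mulr0 ?addr0 //; lra.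
  rewrite ltr_cos2pi; [|by apply/andP; split; lra..].
  by case: (ltP t x) => /=; lra.
(* For x > 1/2 the ray is the set where the sine is negative and the cosine is not below cos (2 pi
   x); the reflection t -> 1 - t reduces this to the first half. *)
have L1 := L2trig_gt0 (L2trigD (L2trig_cst (cos (2 * pi * x))) (L2trigZ (-1) Lc)).
apply: L2trig_ae bx (L2trigM (L2trig_gt0 (L2trigZ (-1) Ls))
  (L2trigD (L2trig_cst 1) (L2trigZ (-1) L1))) _ => t t01.
have /andP[t0 t1] := t01.
rewrite iE !mulN1r -sin2pi_sym sin2pi_gt0; last by apply/andP; split; lra.
rewrite (_ : (1 - t < 2^-1) = (2^-1 < t)); last first.
  by apply/idP/idP => ?; lra.
case: (ltP 2^-1 t) => th /=; last first.
  by rewrite leNgt (_ : t < x) ?mul0r //; lra.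
rewrite subr_gt0 -cos2pi_sym -(cos2pi_sym x) ltr_cos2pi; [|by apply/andP; split; lra..].
rewrite ltrD2l ltrN2.
by case: (ltP t x) => /=; lra.
Qed.

(** The sets whose indicator lies in [L2trig] form a sigma-algebra containing the rays [x, +oo), and
    these generate the Borel sets. *)
Lemma L2trig_indic (E : set R) : measurable E -> L2trig (\1_E).
Proof.
move=> mE; have : <<s @RGenCInfty.G R >> E.
  have : (@ocitv R).-sigma.-measurable E by exact: mE.
  by rewrite RGenCInfty.measurableE.
suff sub : <<s @RGenCInfty.G R >> `<=` [set A | L2trig (\1_A)] by exact: sub.
apply: smallest_sub.
- split.
  + by apply: eq_L2trig (L2trig_cst 0) => t; rewrite indic0.
  + by move=> A LA; rewrite setTD; exact: L2trig_compl.
  + by move=> F LF; exact: L2trig_bigcup.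
by move=> _ [x ->]; exact: L2trig_ray.
Qed.

(** The sum counts the integers k >= 0 below y, so it is the ceiling of y. *)
Lemma step_approx n y : 0 <= y <= n%:R ->
  `|y - \sum_(k < n) (k%:R < y)%R%:R| <= 1.
Proof.
elim: n => [|n ih] /andP[y0]; first by move=> y1; rewrite big_ord0 ler_norml; apply/andP; split; lra.
rewrite big_ord_recr /= -natr1 => yn; case: (ltP n%:R y) => ny.
  rewrite (eq_bigr (fun=> 1)) => [|i _].
    rewrite sumr_const card_ord ler_norml /=; apply/andP; split; lra.
  by rewrite (_ : _ < _) // (lt_trans _ ny) // ltr_nat.
by rewrite addr0; apply: ih; rewrite y0.
Qed.

Theorem bmfun_L2trig f : bmfun f -> L2trig f.
Proof.
move=> bf; have [M fM] := bf.2; pose a := `|M| + 1; have a0 : 0 < a by rewrite ltr_wpDl.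
have fa t : I01 t -> 0 <= (f t + a) / (2 * a) <= 1.
  move=> /fM; rewrite ler_norml => /andP[h1 h2]; have := ler_norm M.
  move=> Ma; rewrite divr_ge0 ?ler_pdivrMr ?mulr_gt0 //; rewrite /a in a0 *; lra.
pose u t := (f t + a) / (2 * a).
have bu : bmfun u.
  apply: eq_bmfun (bmfunM (bmfunD bf (bmfun_cst a)) (bmfun_cst (2 * a)^-1)) => t _.
  by [].
suff Lu : L2trig u.
  apply: eq_L2trig (L2trigD (L2trigZ (2 * a) Lu) (L2trig_cst (- a))) => t.
  by rewrite /u; field; rewrite gt_eqF.
(* With [u] the rescaling of [f] to [0,1], [u_ n] rounds [u] up to a multiple of 1/(n+1); it is a
   combination of indicators of level sets and converges uniformly on [0,1]. *)
pose u_ n t := n.+1%:R^-1 * \sum_(k < n.+1) (k%:R < n.+1%:R * u t)%R%:R : R.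
have du n t : I01 t -> `|u t - u_ n t| <= n.+1%:R^-1.
  move=> Dt; have := fa t Dt; rewrite -/(u t) => /andP[u0 u1].
  have n0 : (0 : R) < n.+1%:R by rewrite ltr0n.
  have : 0 <= n.+1%:R * u t <= n.+1%:R by apply/andP; split; nra.
  move=> /step_approx; set s := \sum_(_ < _) _ => h.
  rewrite /u_ -/s (_ : u t - _ = n.+1%:R^-1 * (n.+1%:R * u t - s)).
    by rewrite normrM gtr0_norm ?invr_gt0 // ler_piMr ?invr_ge0 ?ler0n.
  by field; rewrite gt_eqF.
apply: (@L2trig_cvg _ u_ _ 2).
- move=> n; apply: L2trigZ.
  apply: (@L2trig_sum _ _ (fun k t => (k%:R < n.+1%:R * u t)%R%:R)) => k.
  have bv : bmfun (fun t => n.+1%:R * u t) by exact: bmfunZ.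
  pose E := I01 `&` (fun t => n.+1%:R * u t) @^-1` `]k%:R, +oo[.
  have mE : measurable E by apply: bv.1 => //; exact: measurable_itv.
  have eE t : I01 t -> (k%:R < n.+1%:R * u t)%R%:R = \1_E t :> R.
    move=> Dt; rewrite indicE; congr (nat_of_bool _)%:R; apply/idP/idP.
      by move=> h; apply/mem_set; split=> //=; rewrite in_itv /= andbT.
    by move=> /set_mem[_] /=; rewrite in_itv /= andbT.
  apply: L2trig_ae (L2trig_indic mE) _.
    by apply: eq_bmfun (bmfun_indic mE) => t /set_mem Dt; exact: eE.
  by move=> t /andP[t0 t1]; apply: eE; rewrite /= in_itv /= !ltW.
- move=> n t Dt; have := fa t Dt; rewrite -/(u t) => /andP[u0 u1].
  have n1 : n.+1%:R^-1 <= (1 : R) by rewrite invf_le1 ?ler1n ?ltr0n.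
  have := du n t Dt; move: (u_ n t) (n.+1%:R^-1) n1 => w z z1.
  by rewrite !ler_norml => /andP[h1 h2]; apply/andP; split; lra.
move=> t Dt; apply/subr_cvg0.
have hN : - harmonic @ \oo --> (0 : R) by rewrite -oppr0; apply: cvgN; exact: cvg_harmonic.
apply: squeeze_cvgr hN (@cvg_harmonic R); near=> n.
rewrite -[leLHS]/(- n.+1%:R^-1) /harmonic /=.
have := du n t Dt; move: (u_ n t) (n.+1%:R^-1) => w z.
by rewrite ler_norml => /andP[h1 h2]; apply/andP; split; lra.
Unshelve. all: by end_near.
Qed.

End TrigDensity.

(** * Complex integrals and Fourier coefficients *)

Section ComplexIntegral.
Local Open Scope classical_set_scope.
Variable R : realType.
Local Notation C := (complex R).
Local Notation mu := (@lebesgue_measure R).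
Local Notation I01 := ([set` `[(0:R), 1]%R] : set R).
Local Notation Re := (@complex.Re R).
Local Notation Im := (@complex.Im R).
Local Notation "'In' h" := (Rintegral mu I01 h) (at level 10, h at level 8).
Implicit Types (f g h : R -> C) (x y z : C).

Lemma ReD x y : Re (x + y) = Re x + Re y. Proof. by case: x; case: y. Qed.
Lemma ImD x y : Im (x + y) = Im x + Im y. Proof. by case: x; case: y. Qed.
Lemma ReN x : Re (- x) = - Re x. Proof. by case: x. Qed.
Lemma ImN x : Im (- x) = - Im x. Proof. by case: x. Qed.
Lemma ReM x y : Re (x * y) = Re x * Re y - Im x * Im y.
Proof. by case: x; case: y. Qed.
Lemma ImM x y : Im (x * y) = Re x * Im y + Im x * Re y.
Proof. by case: x; case: y. Qed.
Lemma Re_conj x : Re (conjc x) = Re x. Proof. by case: x. Qed.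
Lemma Im_conj x : Im (conjc x) = - Im x. Proof. by case: x. Qed.
Lemma complexP x y : Re x = Re y -> Im x = Im y -> x = y.
Proof. by case: x; case: y => ? ? ? ? /= -> ->. Qed.

Definition bmcfun f : Prop := bmfun (fun t => Re (f t)) /\ bmfun (fun t => Im (f t)).

Definition cint f : C := Complex (In (fun t => Re (f t))) (In (fun t => Im (f t))).

Lemma bmcfun_cst z : bmcfun (fun=> z).
Proof. by split; exact: bmfun_cst. Qed.

Lemma bmcfunD f g : bmcfun f -> bmcfun g -> bmcfun (fun t => f t + g t).
Proof.
move=> [rf jf] [rg jg]; split.
  by apply: eq_bmfun (bmfunD rf rg) => t _; rewrite ReD.
by apply: eq_bmfun (bmfunD jf jg) => t _; rewrite ImD.
Qed.

Lemma bmcfunM f g : bmcfun f -> bmcfun g -> bmcfun (fun t => f t * g t).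
Proof.
move=> [rf jf] [rg jg]; split.
  by apply: eq_bmfun (bmfunB (bmfunM rf rg) (bmfunM jf jg)) => t _; rewrite ReM.
by apply: eq_bmfun (bmfunD (bmfunM rf jg) (bmfunM jf rg)) => t _; rewrite ImM.
Qed.

Lemma bmcfunZ z f : bmcfun f -> bmcfun (fun t => z * f t).
Proof. by apply: bmcfunM; exact: bmcfun_cst. Qed.

Lemma bmcfunB f g : bmcfun f -> bmcfun g -> bmcfun (fun t => f t - g t).
Proof.
move=> [rf jf] [rg jg]; split.
  by apply: eq_bmfun (bmfunB rf rg) => t _; rewrite ReD ReN.
by apply: eq_bmfun (bmfunB jf jg) => t _; rewrite ImD ImN.
Qed.

Lemma bmcfun_conj f : bmcfun f -> bmcfun (fun t => conjc (f t)).
Proof.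
move=> [rf jf]; split.
  by apply: eq_bmfun rf => t _; rewrite Re_conj.
by apply: eq_bmfun (bmfunN jf) => t _; rewrite Im_conj.
Qed.

Lemma bmcfun_sum (I : Type) (s : seq I) (P : pred I) (F : I -> R -> C) :
  (forall i, bmcfun (F i)) -> bmcfun (fun t => \sum_(i <- s | P i) F i t).
Proof.
move=> bF; elim: s => [|i s ih].
  by under eq_fun do rewrite big_nil; exact: bmcfun_cst.
under eq_fun do rewrite big_cons.
by case: (P i) => //; exact: bmcfunD.
Qed.

Lemma cintD f g : bmcfun f -> bmcfun g ->
  cint (fun t => f t + g t) = cint f + cint g.
Proof.
move=> [rf jf] [rg jg]; apply: complexP; rewrite ?ReD ?ImD /= -RintD //.
  by apply: eq_Rintegral => t _; rewrite ReD.
by apply: eq_Rintegral => t _; rewrite ImD.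
Qed.

Lemma cintZ z f : bmcfun f -> cint (fun t => z * f t) = z * cint f.
Proof.
move=> [rf jf]; apply: complexP.
  rewrite ReM /= -!RintZ // -RintB; [|exact: bmfunZ..].
  by apply: eq_Rintegral => t _; rewrite ReM.
rewrite ImM /= -!RintZ // -RintD; [|exact: bmfunZ..].
by apply: eq_Rintegral => t _; rewrite ImM.
Qed.

Lemma cint0 : cint (fun=> 0) = 0.
Proof. by apply: complexP; rewrite /= Rint_cst. Qed.

Lemma cint_sum_eq0 (I : Type) (s : seq I) (P : pred I) (F : I -> R -> C) :
  (forall i, bmcfun (F i)) -> (forall i, P i -> cint (F i) = 0) ->
  cint (fun t => \sum_(i <- s | P i) F i t) = 0.
Proof.
move=> bF F0; elim: s => [|i s ih].
  by under eq_fun do rewrite big_nil; exact: cint0.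
under eq_fun do rewrite big_cons.
case Pi: (P i) => //; rewrite cintD //; last exact: bmcfun_sum.
by rewrite ih F0 // addr0.
Qed.

(** * Characters of the circle and Laurent polynomials *)

Definition circexp (k : int) (t : R) : C :=
  Complex (cos (2 * pi * k%:~R * t)) (sin (2 * pi * k%:~R * t)).

Lemma circexpD j k t : circexp (j + k) t = circexp j t * circexp k t.
Proof.
apply: complexP; rewrite ?ReM ?ImM /= intrD mulrDr mulrDl ?cosD ?sinD //.
by ring.
Qed.

Lemma circexpN k t : circexp (- k) t = conjc (circexp k t).
Proof.
by apply: complexP; rewrite ?Re_conj ?Im_conj /= intrN mulrN mulNr ?cosN ?sinN.
Qed.

Lemma circexp0 t : circexp 0 t = 1.
Proof. by apply: complexP; rewrite /= mulr0 mul0r ?cos0 ?sin0. Qed.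

Lemma bmcfun_circexp k : bmcfun (circexp k).
Proof. by split; [exact: bmfun_cosZ | exact: bmfun_sinZ]. Qed.

Lemma cos2pi_int (k : int) : cos (2 * pi * k%:~R) = 1 :> R.
Proof.
have nat_case n : cos (2 * pi * n%:R) = 1 :> R.
  elim: n => [|n ih]; first by rewrite mulr0 cos0.
  by rewrite -[RHS]ih -[RHS]cosD2pi; congr cos; rewrite -natr1; ring.
case: k => n; first exact: nat_case.
by rewrite NegzE intrN mulrN cosN; exact: nat_case.
Qed.

Lemma sin2pi_int (k : int) : sin (2 * pi * k%:~R) = 0 :> R.
Proof. by apply: cos1sin0; rewrite cos2pi_int normr1. Qed.

Lemma Rint_FTC2 (f F : R -> R) : continuous f -> (forall t : R, is_derive t (1 : R) F (f t)) ->
  In f = F 1 - F 0.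
Proof.
move=> cf dF; rewrite /Rintegral (@continuous_FTC2 _ f F) //.
- exact: continuous_subspaceT.
- have cF t : {for t, continuous F}.
    by apply/differentiable_continuous/derivable1_diffP; case: (dF t).
  split.
  + by move=> t _; case: (dF t).
  + exact: cvg_at_right_filter (cF 0).
  + exact: cvg_at_left_filter (cF 1).
- by move=> t _; rewrite derive1E; have [] := dF t.
Qed.

Lemma cint_circexp k : k != 0 -> cint (circexp k) = 0.
Proof.
move=> k0; pose a : R := 2 * pi * k%:~R.
have a0 : a != 0 by rewrite !mulf_neq0 ?intr_eq0 // gt_eqF ?pi_gt0.
have dsin (t : R) : is_derive t (1 : R) (fun t => a^-1 * sin (a * t)) (cos (a * t)).
  have d : is_derive t (1 : R) (a^-1 \*: ((@sin R) \o (a \*: id)))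
      (a^-1 *: (cos (a *: t) * (a *: 1))).
    by apply: is_deriveZ; apply: is_derive1_comp.
  by apply: (is_derive_eq d); rewrite /GRing.scale /=; field.
have dcos (t : R) : is_derive t (1 : R) (fun t => - a^-1 * cos (a * t)) (sin (a * t)).
  have d : is_derive t (1 : R) (- a^-1 \*: ((@cos R) \o (a \*: id)))
      (- a^-1 *: (- sin (a *: t) * (a *: 1))).
    by apply: is_deriveZ; apply: is_derive1_comp.
  by apply: (is_derive_eq d); rewrite /GRing.scale /=; field.
apply: complexP => /=.
  rewrite (Rint_FTC2 (@continuous_cosZ _ a) dsin).
  by rewrite mulr1 mulr0 sin2pi_int sin0 subrr.
rewrite (Rint_FTC2 (@continuous_sinZ _ a) dcos).
by rewrite mulr1 mulr0 cos2pi_int cos0 subrr.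
Qed.

Lemma fourier_coefE f k : fourier_coef f k = cint (fun t => f t * circexp (- k) t).
Proof.
apply: complexP; rewrite /fourier_coef /=; apply: eq_Rintegral => t _;
  rewrite ?ReM ?ImM circexpN ?Re_conj ?Im_conj /=; ring.
Qed.

(** A list of pairs (coefficient, exponent) in which exponents may repeat: sums are then
    concatenations, and products are lists of all pairs. *)
Definition laurent (s : seq (C * int)) t : C := \sum_(a <- s) a.1 * circexp a.2 t.

Lemma trigpoly_laurent (p : R -> R) : trigpoly p ->
  exists s, forall t, laurent s t = Complex (p t) 0.
Proof.
elim=> [c|||g h _ [s sP] _ [u uP]|g h _ [s sP] _ [u uP]].
- exists [:: (Complex c 0, 0)] => t.
  by rewrite /laurent big_seq1 /= circexp0 mulr1.
- exists [:: (Complex 2^-1 0, 1); (Complex 2^-1 0, -1)] => t.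
  rewrite /laurent big_cons big_seq1 /= circexpN.
  by apply: complexP; rewrite ?ReD ?ImD ?ReM ?ImM ?Re_conj ?Im_conj /= mulr1; field.
- exists [:: (Complex 0 (- 2^-1), 1); (Complex 0 2^-1, -1)] => t.
  rewrite /laurent big_cons big_seq1 /= circexpN.
  by apply: complexP; rewrite ?ReD ?ImD ?ReM ?ImM ?Re_conj ?Im_conj /= mulr1; field.
- exists (s ++ u) => t; rewrite /laurent big_cat /= -!/(laurent _ _) sP uP.
  by apply: complexP; rewrite ?ReD ?ImD /= ?addr0.
- exists [seq (a.1 * b.1, a.2 + b.2) | a <- s, b <- u] => t.
  rewrite /laurent big_allpairs_dep /=.
  transitivity (laurent s t * laurent u t).
    rewrite /laurent mulr_suml; apply: eq_bigr => a _.
    rewrite mulr_sumr; apply: eq_bigr => b _ /=.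
    by rewrite circexpD mulrACA.
  by rewrite sP uP; apply: complexP; rewrite ?ReM ?ImM /= ?(mulr0, mul0r, subr0, addr0).
Qed.

Definition cnsq z : R := Re z ^+ 2 + Im z ^+ 2.

Lemma bmfun_cnsq f : bmcfun f -> bmfun (fun t => cnsq (f t)).
Proof. by move=> [rf jf]; apply: bmfunD; exact: bmfunX. Qed.

(** Real and imaginary parts are approximated separately by real trigonometric polynomials; the
    coefficients of the second are multiplied by i, and the squared errors add up. *)
Lemma laurent_dense f e : bmcfun f -> 0 < e ->
  exists s, In (fun t => cnsq (f t - laurent s t)) < e.
Proof.
move=> [rf jf] e0.
have [p tp fp] := (bmfun_L2trig rf).2 (e / 2) ltac:(by lra).
have [q tq fq] := (bmfun_L2trig jf).2 (e / 2) ltac:(by lra).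
have [s sP] := trigpoly_laurent tp; have [u uP] := trigpoly_laurent tq.
exists (s ++ [seq (Complex 0 1 * a.1, a.2) | a <- u]).
have bp := trigpoly_bmfun tp; have bq := trigpoly_bmfun tq.
suff -> : In (fun t => cnsq (f t - laurent (s ++ [seq (Complex 0 1 * a.1, a.2) | a <- u]) t))
  = sqdist (fun t => Re (f t)) p + sqdist (fun t => Im (f t)) q by lra.
rewrite /sqdist -RintD; [|exact: bmfun_sqdist..].
apply: eq_Rintegral => t _; rewrite /laurent big_cat /= -/(laurent s t) sP big_map /=.
under eq_bigr do rewrite -mulrA.
rewrite -mulr_sumr -/(laurent u t) uP /cnsq !(ReD, ImD, ReN, ImN, ReM, ImM) /=.
by rewrite !(mul0r, mulr0, mul1r, subr0, add0r, addr0).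
Qed.

(** Approximate f by a Laurent polynomial pp + pm, split into nonnegative and negative frequencies.
    As f - pp is orthogonal to pm, dropping pm does not worsen the approximation; and pp g has
    integral 0. So the integral of f g equals that of (f - pp) g, which is arbitrarily small. *)
Lemma cint_analytic_mul f g : bmcfun f -> bmcfun g ->
  (forall k : nat, (0 < k)%N -> cint (fun t => f t * circexp k%:Z t) = 0) ->
  (forall k : nat, cint (fun t => g t * circexp k%:Z t) = 0) ->
  cint (fun t => f t * g t) = 0.
Proof.
(* The hypothesis on g is stable under complex scalars, so a one-sided bound on the real part,
   applied with the multipliers 1, -1, i and -i, makes the whole integral vanish. *)
suff main g1 : bmcfun f -> bmcfun g1 ->
    (forall k : nat, (0 < k)%N -> cint (fun t => f t * circexp k%:Z t) = 0) ->
    (forall k : nat, cint (fun t => g1 t * circexp k%:Z t) = 0) ->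
    Re (cint (fun t => f t * g1 t)) <= 0.
  move=> bf bg f0 g0.
  have rot z : Re (z * cint (fun t => f t * g t)) <= 0.
    rewrite -cintZ; last exact: bmcfunM.
    under eq_fun do rewrite mulrCA.
    apply: main => //; first exact: bmcfunZ.
    move=> k; under eq_fun do rewrite -mulrA.
    by rewrite cintZ ?g0 ?mulr0 //; apply: bmcfunM => //; exact: bmcfun_circexp.
  apply: complexP; apply/eqP; rewrite eq_le.
    have := rot 1; have := rot (-1); rewrite mulN1r mul1r ReN => h1 h2.
    by apply/andP; split; rewrite /= in h1 h2 *; lra.
  have := rot (Complex 0 1); have := rot (Complex 0 (-1)).
  rewrite !ReM /= !mul0r => h1 h2.
  by apply/andP; split; lra.
move=> bf bg f0 g0; set x := Re _; rewrite leNgt; apply/negP => x0.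
pose K := In (fun t => cnsq (g1 t)).
have K0 : 0 <= K by apply: Rintegral_ge0 => t _; rewrite addr_ge0 ?sqr_ge0.
(* This [e] gives e^2 (1 + K) = e x, so that the bound 2 e x <= e^2 (1 + K) contradicts x > 0. *)
pose e := x / (1 + K); have e0 : 0 < e by rewrite divr_gt0 // ltr_pwDl.
suff : 2 * e * x <= e ^+ 2 * (1 + K).
  have -> : e ^+ 2 * (1 + K) = e * x by rewrite /e; field; rewrite gt_eqF // ltr_pwDl.
  have := mulr_gt0 e0 x0; lra.
have [s sP] := laurent_dense bf (exprn_gt0 2 e0).
pose pp t := \sum_(a <- s | 0 <= a.2) a.1 * circexp a.2 t.
pose pm t := \sum_(a <- s | ~~ (0 <= a.2)) a.1 * circexp a.2 t.
have sE t : laurent s t = pp t + pm t by rewrite /laurent (bigID (fun a => 0 <= a.2)).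
have bpp : bmcfun pp by apply: bmcfun_sum => a; apply: bmcfunZ; exact: bmcfun_circexp.
have bpm : bmcfun pm by apply: bmcfun_sum => a; apply: bmcfunZ; exact: bmcfun_circexp.
pose u t := f t - pp t; have bu : bmcfun u by exact: bmcfunB.
have xE : x = Re (cint (fun t => u t * g1 t)).
  have ppg : cint (fun t => pp t * g1 t) = 0.
    under eq_fun do rewrite /pp mulr_suml.
    apply: cint_sum_eq0 => [a|a a0].
      by apply: bmcfunM => //; apply: bmcfunZ; exact: bmcfun_circexp.
    under eq_fun do rewrite -mulrA [_ * g1 _]mulrC.
    rewrite cintZ; last by apply: bmcfunM => //; exact: bmcfun_circexp.
    by case: a a0 => c [k|k] //= _; rewrite g0 mulr0.
  rewrite /x -[LHS]addr0 -[X in _ + X](_ : Re (cint (fun t => - pp t * g1 t)) = 0).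
    rewrite -ReD -cintD; [|exact: bmcfunM|]; last first.
      apply: bmcfunM => //.
      by have := bmcfunZ (-1) bpp; under eq_fun do rewrite mulN1r.
    by congr (Re (cint _)); apply/funext => t; rewrite mulrBl mulNr.
  under eq_fun do rewrite mulNr -mulN1r.
  by rewrite cintZ ?ppg ?mulr0 //; exact: bmcfunM.
(* Conjugation turns the negative frequencies of [pm] into positive ones; against these [f]
   integrates to 0 by hypothesis, and [pp] because only positive exponents occur in the product. *)
have upm : cint (fun t => u t * conjc (pm t)) = 0.
  have -> : (fun t => u t * conjc (pm t)) =
      (fun t => \sum_(a <- s | ~~ (0 <= a.2)) conjc a.1 * (u t * circexp (- a.2) t)).
    apply/funext => t; rewrite /pm rmorph_sum mulr_sumr; apply: eq_bigr => a _.
    by rewrite rmorphM /= circexpN mulrCA.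
  have buc k : bmcfun (fun t => u t * circexp k t).
    by apply: bmcfunM => //; exact: bmcfun_circexp.
  apply: cint_sum_eq0 => [a|[c [k|k]] //= _]; first exact: bmcfunZ.
  rewrite cintZ //; suff -> : cint (fun t => u t * circexp (- Negz k) t) = 0.
    by rewrite mulr0.
  rewrite NegzE opprK.
  have -> : (fun t => u t * circexp k.+1%:Z t) = (fun t => f t * circexp k.+1%:Z t
      + \sum_(a <- s | 0 <= a.2) - a.1 * circexp (a.2 + k.+1%:Z) t).
    apply/funext => t; rewrite /u mulrBl; congr (_ + _).
    rewrite /pp mulr_suml -sumrN; apply: eq_bigr => a _.
    by rewrite circexpD mulrA !mulNr.
  have bs a : bmcfun (fun t => - a.1 * circexp (a.2 + k.+1%:Z) t).
    by apply: bmcfunZ; exact: bmcfun_circexp.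
  rewrite cintD; last by apply: bmcfun_sum.
    rewrite f0 // add0r; apply: cint_sum_eq0 => // -[d [j|j]] //= _.
    rewrite cintZ; last exact: bmcfun_circexp.
    by rewrite cint_circexp ?mulr0 // -PoszD addnS.
  by apply: bmcfunM => //; exact: bmcfun_circexp.
(* Pythagoras: f - laurent s is u - pm with u orthogonal to pm, so its squared norm is at least that
   of u. *)
have ule : In (fun t => cnsq (u t)) <= e ^+ 2.
  have bR : bmfun (fun t => Re (u t * conjc (pm t))).
    exact: (bmcfunM bu (bmcfun_conj bpm)).1.
  have upm0 : In (fun t => Re (u t * conjc (pm t))) = 0 := congr1 Re upm.
  have bu2 := bmfun_cnsq bu; have b2R := bmfunZ 2 bR.
  have -> : In (fun t => cnsq (u t)) =
      In (fun t => cnsq (u t) - 2 * Re (u t * conjc (pm t))).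
    by rewrite RintB // RintZ // upm0 mulr0 subr0.
  apply: le_trans (ltW sP); apply: ler_Rint; first exact: bmfunB.
    apply: bmfun_cnsq; apply: bmcfunB => //.
    by rewrite (funext sE); exact: bmcfunD.
  move=> t _; rewrite sE opprD addrA -/(u t) ReM Re_conj Im_conj /cnsq.
  rewrite !(ReD, ImD, ReN, ImN).
  have := sqr_ge0 (Re (pm t)); have := sqr_ge0 (Im (pm t)); nra.
rewrite xE /= -RintZ; last exact: (bmcfunM bu bg).1.
rewrite mulrDr mulr1.
apply: (@le_trans _ _ (In (fun t => cnsq (u t) + e ^+ 2 * cnsq (g1 t)))).
  apply: ler_Rint.
  - by apply: bmfunZ; exact: (bmcfunM bu bg).1.
  - apply: bmfunD; first exact: bmfun_cnsq.
    by apply: bmfunZ; exact: bmfun_cnsq.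
  move=> t _; rewrite ReM /cnsq.
  (* Expanding the squared modulus of u - e conj(g1) gives 2 e Re (u g1) <= |u|^2 + e^2 |g1|^2. *)
  have := sqr_ge0 (Re (u t) - e * Re (g1 t)); have := sqr_ge0 (Im (u t) + e * Im (g1 t)).
  nra.
rewrite RintD; [|exact: bmfun_cnsq|by apply: bmfunZ; exact: bmfun_cnsq].
by rewrite RintZ ?lerD2r //; exact: bmfun_cnsq.
Qed.

End ComplexIntegral.

(** * The algebra H^infty and kernels of H^infty matrices *)

Section HardyAlgebra.
Local Open Scope classical_set_scope.
Variable R : realType.
Local Notation C := (complex R).
Local Notation mu := (@lebesgue_measure R).
Local Notation I01 := ([set` `[(0:R), 1]%R] : set R).
Local Notation Re := (@complex.Re R).
Local Notation Im := (@complex.Im R).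
Implicit Types (f g h : R -> C).

Definition mcfun f : Prop := measurable_fun I01 (fun t => Re (f t)) /\
  measurable_fun I01 (fun t => Im (f t)).

Lemma bmcfun_mcfun f : bmcfun f -> mcfun f.
Proof. by move=> [[? _] [? _]]. Qed.

Lemma mcfunD f g : mcfun f -> mcfun g -> mcfun (fun t => f t + g t).
Proof.
move=> [rf jf] [rg jg]; split.
  by apply: eq_measurable_fun (measurable_funD rf rg) => t _ /=; rewrite ReD.
by apply: eq_measurable_fun (measurable_funD jf jg) => t _ /=; rewrite ImD.
Qed.

Lemma mcfunM f g : mcfun f -> mcfun g -> mcfun (fun t => f t * g t).
Proof.
move=> [rf jf] [rg jg]; split.
  have m := measurable_funB (measurable_funM rf rg) (measurable_funM jf jg).
  by apply: eq_measurable_fun m => t _ /=; rewrite ReM.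
have m := measurable_funD (measurable_funM rf jg) (measurable_funM jf rg).
by apply: eq_measurable_fun m => t _ /=; rewrite ImM.
Qed.

Lemma ae_eq_cint f g : mcfun f -> mcfun g ->
  {ae mu, forall t, I01 t -> f t = g t} -> cint f = cint g.
Proof.
move=> [rf jf] [rg jg] fg; apply: complexP => /=; apply: ae_eq_Rint => //.
  by apply: ae01S fg => t ->.
by apply: ae01S fg => t ->.
Qed.

(** Clipping both components at the essential bound changes them only on a null set. The level [|M|]
    keeps the two clipping bounds in order for any sign of M. *)
Lemma Linfty_bmcfun f : Linfty f ->
  exists2 g, bmcfun g & {ae mu, forall t, I01 t -> f t = g t}.
Proof.
move=> [rf [jf [M fM]]].
pose clip (x : R) := Num.min (Num.max x (- `|M|)) `|M|.
have mclip (h : R -> R) : measurable_fun I01 h -> bmfun (fun t => clip (h t)).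
  move=> mh; split.
    apply: (measurable_minr (f := (h \max (fun=> - `|M|))) (g := fun=> `|M|)) => //.
    exact: measurable_maxr.
  exists `|M| => t _; rewrite ler_norml ge_min lexx orbT andbT le_min le_max lexx orbT.
  by rewrite -subr_ge0 opprK addr_ge0.
have clipE (x : R) : `|x| <= M -> clip x = x.
  move=> xM; have := ler_norm M; move: xM; rewrite ler_norml => /andP[h1 h2] MM.
  by rewrite /clip max_l ?min_l //; lra.
exists (fun t => Complex (clip (Re (f t))) (clip (Im (f t)))).
  by split; exact: mclip.
by apply: ae01S fM => t [h1 h2]; apply: complexP; rewrite /= clipE.
Qed.

Lemma bmcfun_Linfty f g : mcfun f -> bmcfun g ->
  {ae mu, forall t, I01 t -> f t = g t} -> Linfty f.
Proof.
move=> [rf jf] [[_ [M gM]] [_ [N gN]]] fg; split=> //; split=> //.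
exists (Num.max M N); have gMN : {ae mu, forall t, I01 t ->
    `|Re (g t)| <= Num.max M N /\ `|Im (g t)| <= Num.max M N}.
  by apply: ae01T => t Dt; rewrite !le_max gM ?gN ?orbT.
by apply: ae01S (ae01I fg gMN) => t [->].
Qed.

(** Fourier coefficients only see the class of f modulo null sets, so they can be computed on a
    bounded representative. Measurability of f itself is kept apart: agreeing almost everywhere with
    a Borel function does not make f Borel. *)
Lemma HinftyP f : Hinfty f <-> mcfun f /\ exists2 g, bmcfun g &
  {ae mu, forall t, I01 t -> f t = g t} /\
  forall k : nat, (0 < k)%N -> cint (fun t => g t * circexp k%:Z t) = 0.
Proof.
have coef g k : mcfun f -> bmcfun g -> {ae mu, forall t, I01 t -> f t = g t} ->
    fourier_coef f (- k) = cint (fun t => g t * circexp k t).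
  move=> mf bg fg; rewrite fourier_coefE opprK.
  have mc := bmcfun_mcfun (bmcfun_circexp R k).
  apply: ae_eq_cint; [exact: mcfunM|by apply: mcfunM => //; exact: bmcfun_mcfun|].
  by apply: ae01S fg => t ->.
split=> [[Lf f0]|[mf [g bg [fg g0]]]].
  have mf : mcfun f by case: Lf => ? [? _].
  split=> //; have [g bg fg] := Linfty_bmcfun Lf; exists g => //; split=> // k k0.
  by rewrite -(coef g) // f0.
split=> [|k k0]; first exact: bmcfun_Linfty bg fg.
by rewrite (coef g) // g0.
Qed.

Lemma Hinfty_cst c : Hinfty (fun=> c : C).
Proof.
have bc := bmcfun_cst c; apply/HinftyP; split; first exact: bmcfun_mcfun.
exists (fun=> c) => //; split; first exact: ae01T.
move=> k k0; rewrite cintZ; last exact: bmcfun_circexp.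
by rewrite cint_circexp ?mulr0 // eqz_nat -lt0n.
Qed.

Lemma HinftyD f g : Hinfty f -> Hinfty g -> Hinfty (fun t => f t + g t).
Proof.
move=> /HinftyP[mf [f1 bf [ff f0]]] /HinftyP[mg [g1 bg [gg g0]]]; apply/HinftyP.
split; first exact: mcfunD.
exists (fun t => f1 t + g1 t); first exact: bmcfunD.
split; first by apply: ae01S (ae01I ff gg) => t [-> ->].
move=> k k0; under eq_fun do rewrite mulrDl.
have bk := bmcfun_circexp R k.
by rewrite cintD ?f0 ?g0 ?addr0 //; exact: bmcfunM.
Qed.

(** The coefficient of f g at -k is the integral of f times g zeta^k, and for k > 0 the second
    factor has only positive frequencies, so [cint_analytic_mul] applies. *)
Lemma Hinfty_mul f g : Hinfty f -> Hinfty g -> Hinfty (fun t => f t * g t).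
Proof.
move=> /HinftyP[mf [f1 bf [ff f0]]] /HinftyP[mg [g1 bg [gg g0]]]; apply/HinftyP.
split; first exact: mcfunM.
exists (fun t => f1 t * g1 t); first exact: bmcfunM.
split; first by apply: ae01S (ae01I ff gg) => t [-> ->].
move=> k k0; have bk := bmcfun_circexp R k.
under eq_fun do rewrite -mulrA.
apply: cint_analytic_mul => //; first exact: bmcfunM.
move=> j; under eq_fun do rewrite -mulrA -circexpD.
by apply: (g0 (k + j)%N); rewrite addn_gt0 k0.
Qed.

Lemma Hinfty_sum (I : Type) (s : seq I) (P : pred I) (F : I -> R -> C) :
  (forall i, Hinfty (F i)) -> Hinfty (fun t => \sum_(i <- s | P i) F i t).
Proof.
move=> HF; elim: s => [|i s ih].
  by under eq_fun do rewrite big_nil; exact: Hinfty_cst.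
under eq_fun do rewrite big_cons.
by case: (P i) => //; exact: HinftyD.
Qed.

Lemma Hinfty_prod (I : Type) (s : seq I) (P : pred I) (F : I -> R -> C) :
  (forall i, Hinfty (F i)) -> Hinfty (fun t => \prod_(i <- s | P i) F i t).
Proof.
move=> HF; elim: s => [|i s ih].
  by under eq_fun do rewrite big_nil; exact: Hinfty_cst.
under eq_fun do rewrite big_cons.
by case: (P i) => //; exact: Hinfty_mul.
Qed.

Lemma HinftyZ c f : Hinfty f -> Hinfty (fun t => c * f t).
Proof. by apply: Hinfty_mul; exact: Hinfty_cst. Qed.

Lemma Hinfty_det n (A : R -> 'M[C]_n) : HinftyM A -> Hinfty (fun t => \det (A t)).
Proof.
move=> HA; apply: Hinfty_sum => s; apply: HinftyZ; apply: Hinfty_prod => i.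
exact: HA.
Qed.

Lemma Hinfty_H2 f : Hinfty f -> H2 f.
Proof.
move=> Hf; split; last by case: Hf.
have /HinftyP[[rf jf] [g [rg jg] [fg _]]] := Hf.
have sq (u v : R -> R) : measurable_fun I01 u -> bmfun v ->
    {ae mu, forall t, I01 t -> u t = v t} ->
    mu.-integrable I01 (fun t => (u t ^+ 2)%:E).
  move=> mgu bv uv; have := bmfun_integrable (bmfunX 2 bv).
  have mu2 : measurable_fun I01 (fun t => u t ^+ 2) by exact: measurable_funX.
  have mv2 : measurable_fun I01 (fun t => v t ^+ 2) by apply: measurable_funX; case: bv.
  move=> /integrableP[_ vfin]; apply/integrableP; split; first exact/measurable_EFinP.
  apply: le_lt_trans vfin; rewrite le_eqVlt; apply/orP; left; apply/eqP.
  apply: ae_eq_integral => //.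
  - by apply: measurableT_comp => //; exact/measurable_EFinP.
  - by apply: measurableT_comp => //; exact/measurable_EFinP.
  by apply: ae01S uv => t /= ->.
split=> //; split=> //; split.
  by apply: sq rg _ => //; apply: ae01S fg => t ->.
by apply: sq jg _ => //; apply: ae01S fg => t ->.
Qed.

Lemma not_ae01_False : ~ {ae mu, forall t, I01 t -> False}.
Proof.
move=> [N [mN N0 sN]]; have : (mu I01 <= mu N)%E.
  by apply: le_measure; rewrite ?inE // => t Dt; apply: sN => /(_ Dt).
by rewrite N0 [X in (X <= _)%E]mu_I01 lee_fin ler10.
Qed.

Lemma ae01_forall (I : finType) (P : I -> R -> Prop) :
  (forall i, {ae mu, forall t, I01 t -> P i t}) ->
  {ae mu, forall t, I01 t -> forall i, P i t}.
Proof.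
move=> aP; suff H (s : seq I) : {ae mu, forall t, I01 t -> forall i, i \in s -> P i t}.
  by apply: ae01S (H (enum I)) => t h i; apply: h; rewrite mem_enum.
elim: s => [|i s ih]; first exact: ae01T.
apply: ae01S (ae01I (aP i) ih) => t [Pi Ps] j.
by rewrite inE => /predU1P[->|/Ps].
Qed.

(** * Cramer's rule over H^infty *)

Definition extend_ord (T : Type) k (h : 'I_k -> T) (x : T) (a : 'I_k.+1) : T :=
  if unlift ord_max a is Some b then h b else x.

Lemma extend_lift (T : Type) k (h : 'I_k -> T) x b :
  extend_ord h x (lift ord_max b) = h b.
Proof. by rewrite /extend_ord liftK. Qed.

Lemma extend_max (T : Type) k (h : 'I_k -> T) x : extend_ord h x ord_max = x.
Proof. by rewrite /extend_ord unlift_none. Qed.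

(* Border a nonvanishing minor of maximal size [k] with an extra column [j] and an
   arbitrary row: expanding the (vanishing) determinant along that row exhibits a
   kernel vector, equal to the minor times [e_j] up to the [k] pivot coordinates. *)
Lemma Hinfty_kernel p q (A : R -> 'M[C]_(p, q)) : HinftyM A ->
  exists X : R -> 'M[C]_(q, q), [/\ HinftyM X,
    {ae mu, forall t, I01 t -> A t *m X t = 0} &
    ~ {ae mu, forall t, I01 t -> (\rank (X t) < q - p)%N}].
Proof.
move=> HA.
(* Rows and columns are chosen by arbitrary maps; a repeated index merely makes the minor vanish. *)
pose minor k (f : 'I_k -> 'I_p) (g : 'I_k -> 'I_q) t : C :=
  \det (\matrix_(a, b) A t (f a) (g b)).
pose P k := exists (f : 'I_k -> 'I_p) (g : 'I_k -> 'I_q), ~ {ae mu, forall t, I01 t -> minor k f g t = 0}.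
(* The empty minor is 1, so a maximal size exists even if the matrix vanishes almost everywhere. *)
have P0 : P 0%N.
  have f0 (T : Type) : 'I_0 -> T by case.
  exists (f0 _), (f0 _) => h; apply: not_ae01_False; apply: ae01S h => t.
  by rewrite /minor det_mx00 => /eqP; rewrite oner_eq0.
have Pp k : P k -> (k <= p)%N.
  move=> [f [g fg]]; have [fI|/negP fI] := boolP (injectiveb f).
    by have := leq_card f (injectiveP _ fI); rewrite !card_ord.
  case: fg; apply: ae01T => t _.
  have /injectivePn[a [b ab fab]] : ~~ injectiveb f by apply/negP.
  by apply: (determinant_alternate ab) => c; rewrite !mxE fab.
have exP : exists k, `[< P k >] by exists 0%N; apply/asboolP.
have ubP k : `[< P k >] -> (k <= p)%N by move=> /asboolP /Pp.
case: (ex_maxnP exP ubP) => k /asboolP[f [g fg]] kmax.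
have fgS (f1 : 'I_k.+1 -> 'I_p) (g1 : 'I_k.+1 -> 'I_q) : {ae mu, forall t, I01 t -> minor _ f1 g1 t = 0}.
  apply: contrapT => h; have : (k.+1 <= k)%N by apply: kmax; apply/asboolP; exists f1, g1.
  by rewrite ltnn.
have kp : (k <= p)%N by apply: Pp; exists f, g.
(* Cofactors along the last row of the minor bordered by column [j]. They do not involve the entries
   of that row, so one vector serves all rows of [A]. *)
pose cf j (b : 'I_k.+1) t : C := (-1) ^+ (k + b) *
  \det (\matrix_(a, c) A t (f a) (extend_ord g j (lift b c))).
pose X t := \matrix_(r, j) \sum_b (r == extend_ord g j b)%:R * cf j b t.
exists X; split.
- move=> r j; under eq_fun do rewrite mxE.
  apply: Hinfty_sum => b; do 2 apply: HinftyZ; apply: Hinfty_det => a c.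
  by under eq_fun do rewrite mxE; exact: HA.
(* Entry (i, j) of the product A X is the minor bordered by row i and column j, expanded along its
   last row; only finitely many null sets are involved. *)
- have AX : {ae mu, forall t, I01 t -> forall ij : 'I_p * 'I_q,
      minor _ (extend_ord f ij.1) (extend_ord g ij.2) t = 0}.
    by apply: ae01_forall => ij; exact: fgS.
  apply: ae01S AX => t h; apply/matrixP => i j; rewrite [RHS]mxE -(h (i, j)) mxE.
  under eq_bigr do rewrite mxE mulr_sumr.
  rewrite exchange_big /= /minor (expand_det_row _ ord_max); apply: eq_bigr => b _.
  rewrite (bigD1 (extend_ord g j b)) //= eqxx mul1r big1 ?addr0 => [|r /negbTE ->].
    rewrite mxE extend_max; congr (_ * (_ * \det _)).
    by apply/matrixP => a c; rewrite !mxE extend_lift.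
  by rewrite mul0r mulr0.
move=> rk; apply: fg; apply: ae01S rk => t rk; apply/eqP/contraT => d0.
move: rk; rewrite ltnNge => /negP[]; apply: (@leq_trans (q - k)); first exact: leq_sub2l.
pose G : 'M[C]_(q, k) := \matrix_(r, c) (r == g c)%:R.
pose K : 'M[C]_(k, q) := \matrix_(c, j) cf j (lift ord_max c) t.
(* Where the minor is nonzero, X differs from an invertible scalar matrix by G K, of rank at most k;
   hence X has rank at least q - k >= q - p. *)
have XE : minor _ f g t *: 1%:M = X t - G *m K.
  apply/matrixP => r j; rewrite !mxE (bigD1_ord ord_max) //= extend_max.
  have -> : cf j ord_max t = minor _ f g t.
    rewrite /cf /minor -signr_odd /= addnn odd_double mul1r; congr (\det _).
    by apply/matrixP => a c; rewrite !mxE extend_lift.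
  rewrite (eq_bigr (fun c => G r c * K c j)) => [|c _]; last by rewrite !mxE extend_lift.
  by rewrite addrK mulrC.
have rkq : q = \rank (minor _ f g t *: (1%:M : 'M[C]_q)).
  by rewrite mxrank_scale_nz ?mxrank1.
rewrite leq_subLR addnC {1}rkq XE.
apply: leq_trans (mxrank_add _ _) _; rewrite leq_add2l mxrank_opp.
exact: leq_trans (mxrankM_maxl _ _) (rank_leq_col _).
Qed.

End HardyAlgebra.

(** * Common multiples of inner functions *)

Lemma rank_leq_cols (F : fieldType) n q l (A : 'M[F]_(n, q)) (B : 'M[F]_(n, l)) :
  (forall c, exists h, col c A = B *m h) -> (\rank A <= l)%N.
Proof.
move=> AB; rewrite -mxrank_tr; apply: leq_trans (rank_leq_row B^T).
apply: mxrankS; apply/row_subP => c; rewrite -tr_col.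
by have [h ->] := AB c; rewrite trmx_mul submxMl.
Qed.

Section CommonMultiple.
Local Open Scope classical_set_scope.
Variable R : realType.
Local Notation C := (complex R).
Local Notation mu := (@lebesgue_measure R).
Local Notation I01 := ([set` `[(0:R), 1]%R] : set R).

Lemma inThetaH2_col n m (T : R -> 'M[C]_(n, m)) j : inThetaH2 T (fun t => col j (T t)).
Proof.
exists (fun=> delta_mx j 0); split; last by apply: ae01T => t _; rewrite colE.
by move=> i; apply: Hinfty_H2; exact: Hinfty_cst.
Qed.

(** Almost every F(t) has all its columns in the range of T(t), which has only m columns. *)
Lemma inThetaH2_rank n m q (T : R -> 'M[C]_(n, m)) (F : R -> 'M[C]_(n, q)) :
  (forall c, inThetaH2 T (fun t => col c (F t))) ->
  {ae mu, forall t, I01 t -> (\rank (F t) <= m)%N}.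
Proof.
move=> TF; have : {ae mu, forall t, I01 t -> forall c, exists h, col c (F t) = T t *m h}.
  apply: ae01_forall => c; have [g [_ Fg]] := TF c.
  by apply: ae01S Fg => t ->; exists (g t).
by apply: ae01S => t; exact: rank_leq_cols.
Qed.

Lemma inner_rank n m (T : R -> 'M[C]_(n, m)) : inner T ->
  {ae mu, forall t, I01 t -> \rank (T t) = m}.
Proof.
move=> [_ TT]; apply: ae01S TT => t TT; apply/eqP; rewrite eqn_leq rank_leq_col /=.
by rewrite -{1}(mxrank1 C m) -TT mxrankM_maxr.
Qed.

Variables (n r : nat) (m : 'I_r -> nat).
Variable Theta_ : forall i : 'I_r, R -> 'M[C]_(n, m i).

Local Notation eqns := ('I_r * 'I_n)%type.
Local Notation unknowns := ('I_n + {i : 'I_r & 'I_(m i)})%type.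

(* The equations [f - Theta_ i g_i = 0] in the unknowns [f, g_1, ..., g_r]. *)
Definition cm_system t : 'M[C]_(#|{: eqns}|, #|{: unknowns}|) :=
  \matrix_(a, b) match enum_val b with
    | inl c => ((enum_val a).2 == c)%:R
    | inr u => if tag u == (enum_val a).1
               then - Theta_ (tag u) t (enum_val a).2 (tagged u) else 0
    end.

(** The rows of the system indexed by (i, a), with a varying, say f = Theta_i g_i, for all columns
    of X at once. *)
Lemma cm_systemP t q (X : 'M[C]_(#|{: unknowns}|, q)) i :
  cm_system t *m X = 0 ->
  \matrix_(a, c) X (enum_rank (inl a)) c =
  Theta_ i t *m (\matrix_(d, c) X (enum_rank (inr (Tagged (fun i => 'I_(m i)) d))) c).
Proof.
move=> SX; apply/matrixP => a c; apply/eqP; rewrite -subr_eq0; apply/eqP.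
have := congr1 (fun M => fun_of_matrix M (enum_rank (i, a)) c) SX.
rewrite [RHS]mxE => <-; rewrite !mxE (reindex enum_rank) /=; last first.
  exact/onW_bij/enum_rank_bij.
rewrite big_sumType /=; congr (_ + _).
  rewrite (bigD1 a) //= big1 ?addr0 => [|b ba]; rewrite !mxE !enum_rankK /=.
    by rewrite eqxx mul1r.
  by rewrite eq_sym (negbTE ba) mul0r.
(* Padding the i-th block with zeros to a double sum matches the sum over the sigma type of
   unknowns. *)
transitivity (\sum_(j < r) \sum_(d < m j) (if j == i then
   - Theta_ j t a d * X (enum_rank (inr (Tagged (fun i => 'I_(m i)) d))) c else 0)).
  rewrite (bigD1 i) //= [X in _ + X]big1 ?addr0 => [|j /negbTE ji].
    by rewrite -sumrN; apply: eq_bigr => d _; rewrite eqxx !mxE mulNr.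
  by rewrite big1 // => d _; rewrite ji.
rewrite sig_big_dep /=; apply: eq_bigr => -[j d] _ /=.
by rewrite !mxE !enum_rankK /=; case: (j == i); rewrite ?mul0r.
Qed.

End CommonMultiple.

Unset Implicit Arguments.

Theorem mainTheorem6 (R : realType) (n r : nat) (m : 'I_r -> nat)
    (Theta_ : forall i : 'I_r, R -> 'M[complex R]_(n, m i))
    (l : nat) (Theta : R -> 'M[complex R]_(n, l)) :
  (0 < r)%N ->
  (forall i, inner (Theta_ i)) ->
  inner Theta ->
  (forall f : R -> 'cV[complex R]_n,
      (forall i, inThetaH2 (Theta_ i) f) <-> inThetaH2 Theta f) ->
  (n%:Z - \sum_(i < r) (n%:Z - (m i)%:Z) <= l%:Z) /\
  (forall i : 'I_r, (l <= m i)%N).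
Proof.
move=> _ inn_ inn lcm; split; last first.
  (* Upper bound: the columns of Theta lie in Theta H^2, hence in Theta_i H^2, so the rank l of
     Theta(t) is at most m_i. *)
  move=> i; have rkl := inner_rank inn.
  have rki : {ae @lebesgue_measure R, forall t,
      [set` `[(0:R), 1]%R]%classic t -> (\rank (Theta t) <= m i)%N}.
    by apply: (inThetaH2_rank (T := Theta_ i)) => c; exact: (lcm _).2 (inThetaH2_col Theta c) i.
  apply: contrapT => li; apply: (@not_ae01_False R).
  by apply: ae01S (ae01I rkl rki) => t [-> /li].
have HS : HinftyM (cm_system Theta_).
  move=> a b; under eq_fun do rewrite mxE.
  case: (enum_val b) => [c|[j d]] /=; first exact: Hinfty_cst.
  case: (j == _); last exact: Hinfty_cst.
  by under eq_fun do rewrite -mulN1r; apply: HinftyZ; exact: (inn_ j).1.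
have [X [HX SX nrk]] := Hinfty_kernel HS.
(* The columns of X solve the system: F collects their components f, and G i their components
   g_i. *)
pose F t : 'M[complex R]_(n, _) := \matrix_(a, c) X t (enum_rank (inl a)) c.
pose G i t : 'M[complex R]_(m i, _) :=
  \matrix_(d, c) X t (enum_rank (inr (Tagged (fun i => 'I_(m i)) d))) c.
have FG i : {ae @lebesgue_measure R, forall t,
    [set` `[(0:R), 1]%R]%classic t -> F t = Theta_ i t *m G i t}.
  by apply: ae01S SX => t; exact: cm_systemP.
have rkF : {ae @lebesgue_measure R, forall t,
    [set` `[(0:R), 1]%R]%classic t -> (\rank (F t) <= l)%N}.
  (* Each column of F lies in every Theta_i H^2, hence in Theta H^2 by the common multiple
     hypothesis. *)
  apply: (inThetaH2_rank (T := Theta)) => c; apply/lcm => i.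
  exists (fun t => col c (G i t)); split.
    by move=> d; apply: Hinfty_H2; under eq_fun do rewrite !mxE; exact: HX.
  by apply: ae01S (FG i) => t ->; rewrite !colE mulmxA.
(* Theta_i^* Theta_i = I gives G i = Theta_i^* F, so every row of X lies in the row space of F. *)
have XF : {ae @lebesgue_measure R, forall t,
    [set` `[(0:R), 1]%R]%classic t -> (\rank (X t) <= \rank (F t))%N}.
  have GF : {ae @lebesgue_measure R, forall t,
      [set` `[(0:R), 1]%R]%classic t -> forall i, G i t = adjmx (Theta_ i t) *m F t}.
    apply: ae01_forall => i; apply: ae01S (ae01I (FG i) (inn_ i).2) => t [-> TT].
    by rewrite mulmxA TT mul1mx.
  apply: ae01S GF => t GF; apply/mxrankS/row_subP => a; rewrite -(enum_valK a).
  case: (enum_val a) => [b|[i d]].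
    by rewrite (_ : row _ _ = row b (F t)) ?row_sub //; apply/rowP => c; rewrite !mxE.
  rewrite (_ : row _ _ = row d (G i t)); last by apply/rowP => c; rewrite !mxE.
  by rewrite GF row_mul submxMl.
(* Otherwise rank X <= rank F <= l would stay below the kernel dimension bound almost everywhere,
   against [nrk]. *)
have lb : (#|{: 'I_n + {i : 'I_r & 'I_(m i)}}| - #|{: 'I_r * 'I_n}| <= l)%N.
  rewrite leqNgt; apply/negP => llt; apply: nrk; apply: ae01S (ae01I XF rkF).
  by move=> t [h1 h2]; exact: leq_ltn_trans (leq_trans h1 h2) llt.
(* There are n + sum m_i unknowns and r n equations; their difference is n - sum (n - m_i). *)
move: lb; rewrite card_sum card_prod card_tagged !card_ord sumnE big_map big_enum /=.
under eq_bigr do rewrite card_ord.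
rewrite leq_subLR -lez_nat !PoszD PoszM => lb.
rewrite sumrB sumr_const card_ord -mulr_natl natz -(big_morph _ PoszD (erefl 0%:Z)).
lra.
Qed.
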